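(* Let $\mathcal{H}$ be a complex infinite-dimensional Hilbert space, let $n>1$ be an integer, and let $A\in B(\mathcal{H})$ satisfy $A^*A^n=A^nA^*$ (equivalently, $A^n$ is normal). Then $H_0(A-\lambda)=(A-\lambda)^{-1}(0)$ for every non-zero $\lambda\in\sigma(A)$, and $H_0(A)=A^{-n}(0)$. In particular, $A$ is polaroid.
   Context: $B(\mathcal{H})$ denotes the algebra of bounded linear operators on $\mathcal{H}$. For $S\in B(\mathcal{H})$, the quasi-nilpotent part of $S$ is $H_0(S)=\{x\in\mathcal{H}:\lim_{m\to\infty}\|S^mx\|^{1/m}=0\}$; $S^{-k}(0)$ denotes the kernel of $S^k$. A point $\lambda$ isolated in $\sigma(S)$ is a pole of $S$ if $0<\mathrm{asc}(S-\lambda)=\mathrm{dsc}(S-\lambda)<\infty$, where ascent/descent are the least $p\ge0$ with $(S-\lambda)^{-p}(0)=(S-\lambda)^{-(p+1)}(0)$, resp. $(S-\lambda)^p(\mathcal{H})=(S-\lambda)^{p+1}(\mathcal{H})$. $S$ is polaroid if every isolated point of $\sigma(S)$ is a pole of $S$. *)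

(* Defs.v *)
From HB Require Import structures.
From mathcomp Require Import all_boot all_order all_algebra.
From mathcomp Require Import all_classical all_reals.
From mathcomp Require Import topology normedtype sequences exp.
From mathcomp Require Import complex.

Set Implicit Arguments.
Unset Strict Implicit.
Unset Printing Implicit Defensive.

Import Order.TTheory GRing.Theory Num.Theory.
Import numFieldNormedType.Exports.
Local Open Scope ring_scope.
Local Open Scope classical_set_scope.

Section Defs.
Variable R : realType.
Local Notation C := (complex R).
Variable H : normedModType C.

(* ip is a (complex, conjugate-linear in the 2nd variable) inner product
   inducing the norm of H: together with completeness of H this makes H a
   complex Hilbert space. *)
Definition is_inner_product (ip : H -> H -> C) : Prop :=
  [/\ forall (a : C) (x y z : H), ip (a *: x + y) z = a * ip x z + ip y z,
      forall x y : H, ip y x = Num.conj (ip x y)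
    & forall x : H, `|x| ^+ 2 = ip x x].

Definition infinite_dim : Prop :=
  forall (k : nat) (v : 'I_k -> H),
    exists x : H, forall c : 'I_k -> C, x <> \sum_(i < k) c i *: v i.

Definition is_adjoint (ip : H -> H -> C) (A B : H -> H) : Prop :=
  forall x y : H, ip (A x) y = ip x (B y).

Definition op_shift (S : H -> H) (l : C) : H -> H := fun x => S x - l *: x.

Definition invertible_op (T : H -> H) : Prop :=
  exists S : H -> H, continuous S /\
    (forall x, S (T x) = x) /\ (forall x, T (S x) = x).

Definition op_spectrum (S : H -> H) : set C :=
  [set l | ~ invertible_op (op_shift S l)].

Definition op_ker (S : H -> H) (k : nat) : set H := [set x | iter k S x = 0].

Definition op_range (S : H -> H) (k : nat) : set H := range (iter k S).

Definition rnorm (x : H) : R := complex.Re `|x|.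

Definition qnil_part (S : H -> H) : set H :=
  [set x | (fun m : nat => rnorm (iter m S x) `^ (m%:R)^-1) @ \oo --> (0 : R)].

Definition is_ascent (S : H -> H) (p : nat) : Prop :=
  op_ker S p = op_ker S p.+1 /\ forall q, (q < p)%N -> op_ker S q <> op_ker S q.+1.

Definition is_descent (S : H -> H) (p : nat) : Prop :=
  op_range S p = op_range S p.+1 /\ forall q, (q < p)%N -> op_range S q <> op_range S q.+1.

Definition isolated_point (K : set C) (l : C) : Prop :=
  K l /\ exists2 e : R, 0 < e & forall m, K m -> complex.Re `|m - l| < e -> m = l.

Definition op_is_pole (S : H -> H) (l : C) : Prop :=
  exists p : nat, (0 < p)%N /\ is_ascent (op_shift S l) p /\ is_descent (op_shift S l) p.

Definition op_polaroid (S : H -> H) : Prop :=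
  forall l, isolated_point (op_spectrum S) l -> op_is_pole S l.

End Defs.

(* Main.v *)
(** Call [x] rapidly decaying for [T] when [|T^k x| = O(r^k)] for every [r > 0].
    The vectors of [H_0(T)] are rapidly decaying.  For a normal operator [S],
    [|S x|^2 <= |S^2 x| |x|], so [|S^k x|] grows at least geometrically and every
    rapidly decaying vector lies in the kernel.  This applies to [S = A^n - l^n];
    for [l <> 0] one returns to [A - l] because [t - l] is a simple factor of
    [t^n - l^n].

    For the poles, let [T = A - l] with [l] isolated in the spectrum.  Means of
    the resolvent of [T] over [2^m]-th roots of unity on a small circle converge
    to an operator [B] that does not depend on the radius, and
    [x - T (B x)] is rapidly decaying for every [x]; hence it lies in a fixed
    kernel [ker T^p], which gives [T^p = T^(p+1) B] and makes ascent and descent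
    finite.  Were they zero, [B] would be a continuous inverse of [T]. *)

Require Import Defs.
From HB Require Import structures.
From mathcomp Require Import all_boot all_order all_algebra.
From mathcomp Require Import all_classical all_reals.
From mathcomp Require Import topology normedtype sequences exp.
From mathcomp Require Import complex.
From mathcomp Require Import ring lra.
Import Order.TTheory GRing.Theory Num.Theory.
Import numFieldNormedType.Exports.
Local Open Scope ring_scope.
Local Open Scope classical_set_scope.

Set Implicit Arguments.
Unset Strict Implicit.
Unset Printing Implicit Defensive.

(** * Norms and moduli as real numbers *)

Lemma normr_rnorm (R : realType) (H : normedModType (complex R)) (x : H) :
  `|x| = ((rnorm x)%:C)%C.
Proof. by rewrite /rnorm RRe_real // ger0_real. Qed.

Lemma rnorm_ge0 (R : realType) (H : normedModType (complex R)) (x : H) :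
  0 <= rnorm x.
Proof. by rewrite -lecR -normr_rnorm; exact: normr_ge0. Qed.

Lemma rnorm0 (R : realType) (H : normedModType (complex R)) :
  rnorm (0 : H) = 0.
Proof. by rewrite /rnorm normr0. Qed.

Lemma rnorm_eq0 (R : realType) (H : normedModType (complex R)) (x : H) :
  rnorm x = 0 -> x = 0.
Proof. by move=> x0; apply: normr0_eq0; rewrite normr_rnorm x0. Qed.

Lemma rnorm_gt0 (R : realType) (H : normedModType (complex R)) (x : H) :
  x <> 0 -> 0 < rnorm x.
Proof.
by move=> x0; rewrite lt_neqAle rnorm_ge0 andbT eq_sym; apply/eqP => /rnorm_eq0.
Qed.

Lemma rnormN (R : realType) (H : normedModType (complex R)) (x : H) :
  rnorm (- x) = rnorm x.
Proof. by rewrite /rnorm normrN. Qed.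

Lemma rnormB (R : realType) (H : normedModType (complex R)) (x y : H) :
  rnorm (x - y) = rnorm (y - x).
Proof. by rewrite -rnormN opprB. Qed.

Lemma ler_rnormD (R : realType) (H : normedModType (complex R)) (x y : H) :
  rnorm (x + y) <= rnorm x + rnorm y.
Proof. by rewrite -lecR rmorphD /= -!normr_rnorm ler_normD. Qed.

Lemma ler_rnormB (R : realType) (H : normedModType (complex R)) (x y : H) :
  rnorm (x - y) <= rnorm x + rnorm y.
Proof. by rewrite -(rnormN y) ler_rnormD. Qed.

Lemma ler_rnorm_sum (R : realType) (H : normedModType (complex R)) (I : Type)
    (s : seq I) (P : pred I) (F : I -> H) :
  rnorm (\sum_(i <- s | P i) F i) <= \sum_(i <- s | P i) rnorm (F i).
Proof.
elim/big_ind2: _ => // [|x1 x2 y1 y2 h1 h2]; first by rewrite rnorm0.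
exact: le_trans (ler_rnormD _ _) (lerD h1 h2).
Qed.

(** Values lie in the ordered field [R] instead of the partially ordered [complex R]. This is
    [rnorm] on [(complex R)^o], so many of its laws are instances of those above. *)
Definition cabs (R : realType) (z : complex R) : R := complex.Re `|z|.

Lemma rnormZ (R : realType) (H : normedModType (complex R)) (a : complex R)
    (x : H) : rnorm (a *: x) = cabs a * rnorm x.
Proof.
apply/eqP; rewrite -(inj_eq (@complexI R)) rmorphM /= -!normr_rnorm.
by rewrite normrZ (normr_rnorm (a : (complex R)^o)).
Qed.

Lemma cabs_ge0 (R : realType) (z : complex R) : 0 <= cabs z.
Proof. exact: (rnorm_ge0 (z : (complex R)^o)). Qed.

Lemma cabs_gt0 (R : realType) (z : complex R) : (0 < cabs z) = (z != 0).
Proof.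
apply/idP/idP => [|/eqP z0]; last exact: (rnorm_gt0 (x := z : (complex R)^o)).
by apply: contraTneq => ->; rewrite /cabs normr0 ltxx.
Qed.

Lemma cabsM (R : realType) (z w : complex R) : cabs (z * w) = cabs z * cabs w.
Proof. exact: (rnormZ z (w : (complex R)^o)). Qed.

Lemma cabs1 (R : realType) : cabs (1 : complex R) = 1.
Proof. by rewrite /cabs normr1. Qed.

Lemma cabsX (R : realType) (z : complex R) k : cabs (z ^+ k) = cabs z ^+ k.
Proof.
by elim: k => [|k IH]; rewrite ?expr0 ?cabs1 // !exprS cabsM IH.
Qed.

Lemma cabsV (R : realType) (z : complex R) : cabs z^-1 = (cabs z)^-1.
Proof.
have [->|z0] := eqVneq z 0; first by rewrite invr0 /cabs normr0 invr0.
have c0 : cabs z != 0 by rewrite gt_eqF // cabs_gt0.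
by apply: (mulfI c0); rewrite -cabsM !divff // cabs1.
Qed.

Lemma cabs_real (R : realType) (a : R) : cabs (a%:C)%C = `|a|.
Proof. by rewrite /cabs normc_def /= expr0n /= addr0 sqrtr_sqr. Qed.

Lemma ler_cabsD (R : realType) (z w : complex R) :
  cabs (z + w) <= cabs z + cabs w.
Proof. exact: (ler_rnormD (z : (complex R)^o) w). Qed.

Lemma cabsB (R : realType) (z w : complex R) : cabs (z - w) = cabs (w - z).
Proof. exact: (rnormB (z : (complex R)^o) w). Qed.

Lemma rnorm_cvgP (R : realType) (H : normedModType (complex R)) (u : nat -> H)
    (l : H) :
  (u @ \oo --> l) <->
  (forall e : R, 0 < e -> exists N, forall n, (N <= n)%N -> rnorm (u n - l) < e).
Proof.
split=> [ul e e0|ul].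
  have e0' : 0 < (e%:C)%C :> complex R by rewrite ltcR.
  have /cvgrPdist_lt/(_ _ e0')[N _ hN] := ul.
  exists N => n Nn; have := hN n Nn; rewrite /= normr_rnorm ltcR rnormB //.
apply/cvgrPdist_lt => e e0.
have er : e = ((complex.Re e)%:C)%C by rewrite RRe_real ?gtr0_real.
have [|N hN] := ul (complex.Re e); first by rewrite -ltcR -er.
by exists N => // n Nn /=; rewrite er normr_rnorm ltcR rnormB hN.
Qed.

Lemma rnorm_cauchy_cvg (R : realType) (H : completeNormedModType (complex R))
    (u : nat -> H) :
  (forall e : R, 0 < e -> exists N, forall n, (N <= n)%N -> rnorm (u n - u N) < e) ->
  exists l : H, u @ \oo --> l.
Proof.
move=> hu; suff: cvg (u @ \oo) by move=> h; exists (lim (u @ \oo)).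
apply/cauchy_cvgP/cauchy_exP => e e0.
have er : e = ((complex.Re e)%:C)%C by rewrite RRe_real ?gtr0_real.
have [|N hN] := hu (complex.Re e); first by rewrite -ltcR -er.
exists (u N); exists N => // n Nn /=; rewrite -ball_normE /= er normr_rnorm ltcR.
by rewrite rnormB hN.
Qed.

Lemma continuous_linear_rnorm (R : realType) (H : normedModType (complex R))
    (A : {linear H -> H}) : continuous A ->
  exists2 M, 0 < M & forall x, rnorm (A x) <= M * rnorm x.
Proof.
move=> /linear_bounded_continuous/linear_boundedP.
move=> /pinfty_ex_gt0[M M0 hM].
have Mr : M = ((complex.Re M)%:C)%C by rewrite RRe_real ?gtr0_real.
exists (complex.Re M); first by rewrite -ltcR -Mr.
move=> x; have := hM x; rewrite Mr !normr_rnorm -rmorphM /= lecR //.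
Qed.

Lemma rnorm_bound_continuous (R : realType) (H : normedModType (complex R))
    (f : H -> H) (M : R) :
  (forall x y, rnorm (f x - f y) <= M * rnorm (x - y)) -> continuous f.
Proof.
move=> hf x; apply/cvgrPdist_lt => e e0.
have er : e = ((complex.Re e)%:C)%C by rewrite RRe_real ?gtr0_real.
have e0' : 0 < complex.Re e by rewrite -ltcR -er.
have M0 : 0 < `|M| + 1 by rewrite ltr_wpDl.
have d0 : 0 < ((complex.Re e / (`|M| + 1))%:C)%C :> complex R.
  by rewrite ltcR divr_gt0.
have := nbhsx_ballx x _ d0; rewrite -ball_normE.
apply: filterS => t /=; rewrite er !normr_rnorm !ltcR => h.
apply: le_lt_trans (hf _ _) _.
have := ler_norm M; have := rnorm_ge0 (x - t).
rewrite ltr_pdivlMr // in h.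
nra.
Qed.

(** * Rapid decay and normal operators *)

Section InnerProduct.
Variables (R : realType) (H : normedModType (complex R)).
Variables (ip : H -> H -> complex R) (hip : is_inner_product ip).

Lemma ipDZl a x y z : ip (a *: x + y) z = a * ip x z + ip y z.
Proof. by case: hip. Qed.

Lemma ipC x y : ip y x = Num.conj (ip x y).
Proof. by case: hip. Qed.

Lemma ip0l z : ip 0 z = 0.
Proof. by have := ipDZl (-1) 0 0 z; rewrite scaler0 addr0 mulN1r addNr. Qed.

Lemma ipBZl a x y z : ip (x - a *: y) z = ip x z - a * ip y z.
Proof. by rewrite addrC -scaleNr ipDZl mulNr addrC. Qed.

Lemma ipDZr a x y z : ip z (a *: x + y) = Num.conj a * ip z x + ip z y.
Proof. by rewrite ipC ipDZl rmorphD rmorphM /= -!ipC. Qed.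

Lemma ipBZr a x y z : ip z (x - a *: y) = ip z x - Num.conj a * ip z y.
Proof. by rewrite ipC ipBZl rmorphB rmorphM /= -!ipC. Qed.

Lemma ip_rnorm x : ip x x = ((rnorm x ^+ 2)%:C)%C.
Proof. by have [_ _ <-] := hip; rewrite normr_rnorm rmorphXn. Qed.

Lemma ip_eq0 x : ip x x = 0 -> x = 0.
Proof.
rewrite ip_rnorm => /(congr1 (@complex.Re R)) /= /eqP.
by rewrite sqrf_eq0 => /eqP/rnorm_eq0.
Qed.

Lemma ip_inj u v : (forall x, ip x u = ip x v) -> u = v.
Proof.
move=> uv; apply/subr0_eq/ip_eq0.
by rewrite -[X in ip _ (_ - X)]scale1r ipBZr rmorph1 mul1r uv subrr.
Qed.

Lemma Re_conj (z : complex R) : complex.Re (Num.conj z) = complex.Re z.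
Proof. by case: z. Qed.

(** Cauchy-Schwarz: expand the squared norm of [x - t y] for the real [t = |x| / |y|], which makes
    the two square terms equal. *)
Lemma Re_ip_le x y : complex.Re (ip x y) <= rnorm x * rnorm y.
Proof.
have [->|/rnorm_gt0 y0] := pselect (y = 0).
  by rewrite ipC ip0l rmorph0 rnorm0 mulr0.
pose t := rnorm x / rnorm y.
have := sqr_ge0 (rnorm (x - (t%:C)%C *: y)).
have -> : rnorm (x - (t%:C)%C *: y) ^+ 2 =
    rnorm x ^+ 2 - 2 * t * complex.Re (ip x y) + t ^+ 2 * rnorm y ^+ 2.
  have -> : rnorm (x - (t%:C)%C *: y) ^+ 2 =
    complex.Re (ip (x - (t%:C)%C *: y) (x - (t%:C)%C *: y)) by rewrite ip_rnorm.
  rewrite ipBZl !ipBZr !ip_rnorm (ipC x y).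
  have -> : Num.conj (t%:C)%C = (t%:C)%C by exact: conjc_real.
  case: (ip x y) => a b /=; ring.
have -> : t ^+ 2 * rnorm y ^+ 2 = rnorm x ^+ 2 by rewrite /t; field; rewrite gt_eqF.
have [->|x0] := pselect (x = 0); first by rewrite ip0l rnorm0 mul0r.
move: (rnorm_gt0 x0) => {}x0.
have -> : 2 * t * complex.Re (ip x y) =
  2 * rnorm x * (complex.Re (ip x y) / rnorm y) by rewrite /t; ring.
set w := _ / _ => h.
have : w <= rnorm x by nra.
by rewrite /w ler_pdivrMr.
Qed.

Variables (S Ss : H -> H) (hadj : is_adjoint ip S Ss).

Lemma adjoint_scale_add a x y : Ss (a *: x + y) = a *: Ss x + Ss y.
Proof.
by apply: ip_inj => z; rewrite -hadj !ipDZr !hadj.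
Qed.

Lemma is_adjoint_iter k : is_adjoint ip (iter k S) (iter k Ss).
Proof.
by elim: k => [//|k IH] x y; rewrite iterS hadj IH -iterSr.
Qed.

Lemma is_adjoint_shift m :
  is_adjoint ip (op_shift S m) (op_shift Ss (Num.conj m)).
Proof. by move=> x y; rewrite /op_shift ipBZl ipBZr hadj conjCK. Qed.

Hypothesis hcomm : forall x, Ss (S x) = S (Ss x).

(** Writing S* for [Ss], both squares equal [<S S* v, v> = <S* S v, v>]. *)
Lemma rnorm_adjoint v : rnorm (Ss v) = rnorm (S v).
Proof.
apply/eqP; rewrite -(@eqrXn2 _ 2) ?rnorm_ge0 //; apply/eqP.
have -> : rnorm (Ss v) ^+ 2 = complex.Re (ip (Ss v) (Ss v)) by rewrite ip_rnorm.
by rewrite -hadj -hcomm ipC -hadj Re_conj ip_rnorm.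
Qed.

(** [|S x|^2 = <x, S* S x> <= |x| |S* (S x)|], and normality replaces S* by S in the last norm. *)
Lemma normal_paranormal x : rnorm (S x) ^+ 2 <= rnorm (S (S x)) * rnorm x.
Proof.
have -> : rnorm (S x) ^+ 2 = complex.Re (ip (S x) (S x)) by rewrite ip_rnorm.
by rewrite hadj mulrC -rnorm_adjoint; exact: Re_ip_le.
Qed.

End InnerProduct.

(** A shift of a normal operator is again normal: [S - m] commutes with its adjoint
    [Ss - conj m]. *)
Lemma normal_shift_paranormal (R : realType) (H : normedModType (complex R))
    (ip : H -> H -> complex R) (hip : is_inner_product ip)
    (S : {linear H -> H}) (Ss : H -> H) (hadj : is_adjoint ip S Ss)
    (hcomm : forall x, Ss (S x) = S (Ss x)) (m : complex R) x :
  rnorm (op_shift S m x) ^+ 2 <=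
  rnorm (op_shift S m (op_shift S m x)) * rnorm x.
Proof.
apply: (normal_paranormal hip (is_adjoint_shift hip hadj m)) => {}x.
have SsB a u v : Ss (u - a *: v) = Ss u - a *: Ss v.
  by rewrite addrC -scaleNr (adjoint_scale_add hip hadj) scaleNr addrC.
have SB a u v : S (u - a *: v) = S u - a *: S v by rewrite linearB linearZ.
rewrite /op_shift SsB SB hcomm !scalerBr !scalerA (mulrC m) !opprB -!addrA.
by congr (_ + _); rewrite addrC -addrA addrCA.
Qed.

(** A root-free form of quasi-nilpotency at [x]; geometric bounds are easy to transport through
    bounded operators and powers. *)
Definition rapid_decay (R : realType) (H : normedModType (complex R))
    (T : H -> H) (x : H) : Prop :=
  forall r : R, 0 < r ->
    exists C : R, forall k, rnorm (iter k T x) <= C * r ^+ k.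

Lemma eventually_le_geometric (R : realType) (u : nat -> R) (r : R) N :
  0 < r -> (forall k, 0 <= u k) -> (forall k, (N <= k)%N -> u k <= r ^+ k) ->
  exists C, forall k, u k <= C * r ^+ k.
Proof.
(* The 1 serves the tail, the sum serves the finitely many initial terms. *)
move=> r0 u0 hu; exists (1 + \sum_(i < N) u i / r ^+ i) => k.
have t0 (i : 'I_N) : true -> 0 <= u i / r ^+ i.
  by move=> _; rewrite divr_ge0 // exprn_ge0 // ltW.
have [Nk|kN] := leqP N k.
  rewrite mulrDl mul1r ler_wpDr ?hu // mulr_ge0 ?exprn_ge0 ?(ltW r0) //.
  by apply: sumr_ge0 => i _; exact: t0.
rewrite -ler_pdivrMr ?exprn_gt0 // (bigD1 (Ordinal kN)) //= ler_wpDl //.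
rewrite ler_wpDr // sumr_ge0 // => i _; exact: t0.
Qed.

Lemma qnil_rapid_decay (R : realType) (H : normedModType (complex R))
    (T : H -> H) x : qnil_part T x -> rapid_decay T x.
Proof.
move=> /cvgrPdist_lt hx r r0.
have [N _ hN] := hx _ r0.
(* Starting at [N.+1] forces [k > 0], so that the k-th power undoes the k-th root. *)
apply: (@eventually_le_geometric _ (fun k => rnorm (iter k T x)) _ N.+1) => //.
  by move=> k; exact: rnorm_ge0.
move=> k Nk; have /= := hN k (ltnW Nk).
rewrite sub0r normrN ger0_norm ?powR_ge0 // => /ltW h.
have k0 : (k%:R : R) != 0 by rewrite pnatr_eq0; case: k Nk {h}.
rewrite -[leLHS]powRr1 ?rnorm_ge0 // -(mulVf k0) powRrM powR_mulrn ?powR_ge0 //.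
by rewrite lerXn2r // nnegrE ?powR_ge0 // ltW.
Qed.

Lemma iter_ker (R : realType) (H : normedModType (complex R))
    (T : {linear H -> H}) p m x :
  (p <= m)%N -> iter p T x = 0 -> iter m T x = 0.
Proof.
move=> pm px; rewrite -(subnK pm) iterD px.
by elim: (m - p)%N => [//|k IH]; rewrite iterS IH linear0.
Qed.

Lemma ker_qnil (R : realType) (H : normedModType (complex R))
    (T : {linear H -> H}) p : op_ker T p `<=` qnil_part T.
Proof.
(* The index 0 has to be avoided, since there the exponent is 0 and the power of 0 is 1. *)
move=> x px; apply/cvgrPdist_lt => e e0; exists p.+1 => // m pm /=.
rewrite (iter_ker (ltnW pm) px) rnorm0 sub0r normrN powR0 ?normr0 //.
by rewrite invr_eq0 pnatr_eq0; case: m pm.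
Qed.

(** If [a > 0], the bounds say [2^k <= C / a] for every [k], which is absurd. *)
Lemma geometric_le0 (R : realType) (q a C : R) : 0 < q ->
  (forall k, q ^+ k * a <= C * (q / 2) ^+ k) -> a <= 0.
Proof.
move=> q0 h; rewrite leNgt; apply/negP => a0.
have := @upper_nthrootP _ (C / a) _ (leqnn _); set k := Num.bound _.
rewrite ltNge ler_pdivlMr // => /negP; apply.
have := h k; rewrite exprMn exprVn mulrCA ler_pM2l ?exprn_gt0 //.
by rewrite ler_pdivlMr ?exprn_gt0 // mulrC.
Qed.

(** If [S x] is non-zero, the ratios [|S^(k+1) x| / |S^k x|] never fall below the first one, [q]. So
    [|S^k x| >= q^k |x|], which excludes decay at rate [q / 2]. *)
Lemma paranormal_rapid_decay (R : realType) (H : normedModType (complex R))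
    (S : {linear H -> H}) :
  (forall x, rnorm (S x) ^+ 2 <= rnorm (S (S x)) * rnorm x) ->
  forall x, rapid_decay S x -> S x = 0.
Proof.
move=> pS x dx; apply: contrapT => Sx0.
have x0 : x <> 0 by move=> x0; apply: Sx0; rewrite x0 linear0.
move: (rnorm_gt0 x0) (rnorm_gt0 Sx0) => {}x0 {}Sx0.
pose q := rnorm (S x) / rnorm x; have q0 : 0 < q by rewrite divr_gt0.
have step k : 0 < rnorm (iter k S x) /\ q * rnorm (iter k S x) <= rnorm (iter k.+1 S x).
  elim: k => [|k [IH1 IH2]]; first by split; rewrite //= /q divfK ?gt_eqF.
  have h1 : 0 < rnorm (iter k.+1 S x) by apply: lt_le_trans IH2; exact: mulr_gt0.
  split=> //; rewrite -(ler_pM2r IH1); apply: le_trans (pS _).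
  by rewrite expr2 mulrAC ler_pM2r.
have grow k : q ^+ k * rnorm x <= rnorm (iter k S x).
  elim: k => [|k IH]; first by rewrite mul1r.
  apply: le_trans (proj2 (step k)); rewrite exprS -mulrA ler_pM2l //.
have [C hC] := dx (q / 2) (divr_gt0 q0 (ltr0Sn _ 1)).
have := geometric_le0 q0 (fun k => le_trans (grow k) (hC k)).
by rewrite leNgt x0.
Qed.

(* Algebraically [A^n - l^n = Q(A) T] and [Q(A) = n l^(n-1) + W(A) T] with [T = A - l]. *)
Lemma power_sub_factor (R : realType) (H : normedModType (complex R))
    (A : {linear H -> H}) (cA : continuous A) (l : complex R) n :
  exists Q W : H -> H, exists2 M : R, 0 <= M &
  [/\ forall x, rnorm (Q x) <= M * rnorm x,
      forall x, rnorm (W x) <= M * rnorm x,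
      forall x, Q (op_shift A l x) = op_shift A l (Q x),
      forall x, op_shift (iter n A) (l ^+ n) x = Q (op_shift A l x)
    & forall x, Q x = (n%:R * l ^+ n.-1) *: x + W (op_shift A l x)].
Proof.
have [MA MA0 hMA] := continuous_linear_rnorm cA.
have AB a u v : A (u - a *: v) = A u - a *: A v by rewrite linearB linearZ.
have AD a u v : A (u + a *: v) = A u + a *: A v by rewrite linearD linearZ.
elim: n => [|n [Q [W [M M0 [bQ bW cQ fQ eQ]]]]].
  exists (fun=> 0), (fun=> 0), 0 => //; split => // x.
  - by rewrite rnorm0 mul0r.
  - by rewrite rnorm0 mul0r.
  - by rewrite /op_shift linear0 scaler0 subrr.
  - by rewrite /op_shift /= expr0 scale1r subrr.
  - by rewrite mul0r scale0r addr0.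
(* From [A^(n+1) - l^(n+1) = A (A^n - l^n) + l^n (A - l)]. For [W], substitute [A Q = Q T + l Q] and
   expand the second [Q] by induction. *)
exists (fun x => A (Q x) + l ^+ n *: x), (fun x => Q x + l *: W x).
exists (MA * M + cabs (l ^+ n) + M + cabs l * M).
  by rewrite !addr_ge0 ?mulr_ge0 ?cabs_ge0 // ltW.
have c0 := cabs_ge0 l; have cn0 := cabs_ge0 (l ^+ n).
split=> x.
- apply: le_trans (ler_rnormD _ _) _; rewrite rnormZ !mulrDl.
  have h1 := hMA (Q x); have h2 := bQ x; have := rnorm_ge0 x.
  have := rnorm_ge0 (Q x).
  have : MA * rnorm (Q x) <= MA * M * rnorm x by rewrite -mulrA ler_pM2l.
  have : 0 <= M * rnorm x by rewrite mulr_ge0 ?rnorm_ge0.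
  have : 0 <= cabs l * M * rnorm x by rewrite !mulr_ge0 ?rnorm_ge0.
  lra.
- apply: le_trans (ler_rnormD _ _) _; rewrite rnormZ !mulrDl.
  have h1 := bQ x; have := ler_wpM2l c0 (bW x); rewrite mulrA.
  have : 0 <= MA * M * rnorm x by rewrite !mulr_ge0 ?rnorm_ge0 // ltW.
  have : 0 <= cabs (l ^+ n) * rnorm x by rewrite !mulr_ge0 ?rnorm_ge0.
  lra.
- rewrite cQ /op_shift AB AD !scalerBr !scalerDr !scalerA.
  by rewrite (mulrC l) addrACA opprD.
- by rewrite -fQ /op_shift /= AB scalerBr scalerA -exprSr addrA subrK.
have -> : A (Q x) =
    Q (op_shift A l x) + l *: ((n%:R * l ^+ n.-1) *: x + W (op_shift A l x)).
  by rewrite -eQ cQ /op_shift subrK.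
rewrite scalerDr scalerA -!addrA [RHS]addrC -!addrA; congr (_ + _).
rewrite addrCA; congr (_ + _).
rewrite -scalerDl; congr (_ *: _).
case: n {fQ eQ cn0} => [|n] /=; first by rewrite !mul0r mulr0 add0r expr0 mul1r.
by rewrite mulrCA -exprS -[in RHS]natr1 mulrDl mul1r.
Qed.

Lemma rnorm_iter_le (R : realType) (H : normedModType (complex R))
    (T : H -> H) (M : R) k x : 0 <= M ->
  (forall x, rnorm (T x) <= M * rnorm x) -> rnorm (iter k T x) <= M ^+ k * rnorm x.
Proof.
move=> M0 hM; elim: k => [|k IH]; first by rewrite mul1r.
by rewrite iterS (le_trans (hM _)) // exprS -mulrA ler_wpM2l.
Qed.

(** Since [A^n - l^n = Q T] kills [x], [Q] kills every [y = T^k (T x)]. On such [y] the second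
    factorization reads [n l^(n-1) y = - W (T y)], so [T] is bounded below there by a positive
    constant, and its iterates can decay rapidly only if [T x = 0]. *)
Lemma power_rapid_decay (R : realType) (H : normedModType (complex R))
    (A : {linear H -> H}) (cA : continuous A) (l : complex R) n :
  (0 < n)%N -> l != 0 ->
  (forall x, rapid_decay (op_shift (iter n A) (l ^+ n)) x ->
     op_shift (iter n A) (l ^+ n) x = 0) ->
  forall x, rapid_decay (op_shift A l) x -> op_shift A l x = 0.
Proof.
move=> n0 l0 hN x dx.
have [Q [W [M M0 [bQ bW cQ fQ eQ]]]] := power_sub_factor cA l n.
set T := op_shift A l in cQ fQ eQ dx *.
have iQ k y : iter k (op_shift (iter n A) (l ^+ n)) y = iter k Q (iter k T y).
  elim: k y => [//|k IH] y; rewrite iterSr IH fQ (iterSr _ T) iterS.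
  have -> z : iter k T (Q z) = Q (iter k T z).
    by elim: k {IH} z => [//|k IH] z; rewrite !iterS IH cQ.
  by rewrite -iterSr.
have Nx : op_shift (iter n A) (l ^+ n) x = 0.
  (* The k-th iterate is [Q^k T^k x], of norm at most [M^k |T^k x|]; decay of [T] at rate
     [r / (M + 1)] absorbs [M^k]. *)
  apply: hN => r r0; have M1 : 0 < M + 1 by rewrite ltr_wpDl.
  have [C hC] := dx (r / (M + 1)) (divr_gt0 r0 M1); exists C => k.
  rewrite iQ (le_trans (rnorm_iter_le _ _ M0 bQ)) // (le_trans (ler_wpM2l _ (hC k))) ?exprn_ge0 //.
  have C0 : 0 <= C by have := hC 0%N; rewrite mulr1; apply: le_trans (rnorm_ge0 _).
  rewrite mulrCA ler_wpM2l // exprMn exprVn mulrCA ler_piMr ?exprn_ge0 ?(ltW r0) //.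
  by rewrite ler_pdivrMr ?exprn_gt0 // mul1r lerXn2r ?nnegrE ?lerDl // ltW.
have Q0 : Q 0 = 0.
  apply: rnorm_eq0; apply/eqP.
  by rewrite eq_le rnorm_ge0 (le_trans (bQ _)) // rnorm0 mulr0.
have T0 : T 0 = 0 by rewrite /T /op_shift linear0 scaler0 subrr.
have QT k : Q (iter k T (T x)) = 0.
  by elim: k => [|k IH]; rewrite ?iterS ?cQ ?IH ?T0 // -cQ -fQ.
pose c := cabs (n%:R * l ^+ n.-1).
have c0 : 0 < c by rewrite cabs_gt0 mulf_neq0 ?expf_neq0 // pnatr_eq0 -lt0n.
have M1 : 0 < M + 1 by rewrite ltr_wpDl.
pose q := c / (M + 1); have q0 : 0 < q by rewrite divr_gt0.
have low k : q ^+ k * rnorm (T x) <= rnorm (iter k T (T x)).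
  elim: k => [|k IH]; first by rewrite mul1r.
  rewrite exprS -mulrA (le_trans (ler_wpM2l (ltW q0) IH)) //.
  rewrite /q mulrAC ler_pdivrMr // -rnormZ.
  have := eQ (iter k T (T x)); rewrite QT => /esym/eqP.
  rewrite addr_eq0 => /eqP ->; rewrite rnormN (le_trans (bW _)) // mulrC -iterS.
  by rewrite ler_wpM2l ?rnorm_ge0 // lerDl.
have [C hC] := dx (q / 2) (divr_gt0 q0 (ltr0Sn _ 1)).
apply: rnorm_eq0; apply/eqP; rewrite eq_le rnorm_ge0 andbT.
apply: (@geometric_le0 _ q _ (C * (q / 2))) => // k.
by rewrite (le_trans (low k)) // -iterSr (le_trans (hC _)) // exprS mulrA.
Qed.

Lemma iter_rapid_decay (R : realType) (H : normedModType (complex R))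
    (A : H -> H) n x : (0 < n)%N -> rapid_decay A x -> rapid_decay (iter n A) x.
Proof.
(* With a rate [s <= 1], [s^(n k) <= s^k]; capping [r] at 1 ensures this. *)
move=> n0 dx r r0; have s0 : 0 < Num.min r 1 by rewrite lt_min r0 ltr01.
have [C hC] := dx _ s0; exists C => k.
have C0 : 0 <= C by have := hC 0%N; rewrite mulr1; apply: le_trans (rnorm_ge0 _).
rewrite -iterM (le_trans (hC _)) // ler_wpM2l //.
rewrite (@le_trans _ _ (Num.min r 1 ^+ k)) //.
  by rewrite ler_wiXn2l ?ge_min ?lexx ?orbT ?leq_pmulr // ltW.
by rewrite lerXn2r ?nnegrE ?ge_min ?lexx // ltW.
Qed.

(** * Discrete contour integrals *)

Lemma rnorm_geometric_cvg (R : realType) (H : completeNormedModType (complex R))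
    (u : nat -> H) (C : R) :
  (forall m, rnorm (u m.+1 - u m) <= C * (3 / 4) ^+ m) ->
  exists l : H, u @ \oo --> l.
Proof.
move=> hu; have C0 : 0 <= C.
  by have := hu 0%N; rewrite mulr1; apply: le_trans (rnorm_ge0 _).
have s0 : 0 <= 3 / 4 :> R by lra.
(* The bound is an exact geometric partial sum, with [4 = 1 / (1 - 3/4)]. *)
have tail m k : rnorm (u (m + k)%N - u m) <= 4 * C * ((3 / 4) ^+ m - (3 / 4) ^+ (m + k)).
  elim: k => [|k IH]; first by rewrite addn0 !subrr rnorm0 mulr0.
  rewrite addnS -(subrKA (u (m + k)%N)) (le_trans (ler_rnormD _ _)) //.
  apply: le_trans (lerD (hu _) IH) _; rewrite exprS; lra.
apply: rnorm_cauchy_cvg => e e0.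
have C1 : 0 < 4 * C + 1 by lra.
have /cvgrPdist_lt/(_ _ (divr_gt0 e0 C1))[N _ hN] :
    (fun n => (3 / 4 : R) ^+ n) @ \oo --> (0 : R).
  by apply: cvg_expr; rewrite ger0_norm //; lra.
exists N => n Nn; rewrite -(subnKC Nn) (le_lt_trans (tail _ _)) //.
have := hN N (leqnn N); rewrite /= sub0r normrN ger0_norm ?exprn_ge0 //.
rewrite ltr_pdivlMr // => h.
have := exprn_ge0 (N + (n - N)) s0; have := exprn_ge0 N s0.
set a := _ ^+ N in h *; set b := _ ^+ _; move=> a0 b0.
have : 0 <= C * b by rewrite mulr_ge0.
rewrite mulrBr; nra.
Qed.

(** Cutting [[a, b]] into [J] equal pieces bounds the total increment by [K (b - a)^2 / J], which is
    arbitrarily small. *)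
Lemma quadratic_increments_const (R : realType) (H : normedModType (complex R))
    (f : R -> H) (K a b : R) : a <= b ->
  (forall s t, a <= s <= b -> a <= t <= b ->
     rnorm (f t - f s) <= K * (t - s) ^+ 2) ->
  f a = f b.
Proof.
move=> ab hf; apply/esym/subr0_eq/rnorm_eq0/eqP; rewrite eq_le rnorm_ge0 andbT.
rewrite leNgt; apply/negP => p0.
set p := rnorm _ in p0.
have K0 : 0 <= K * (b - a) ^+ 2.
  by apply: le_trans (rnorm_ge0 _) (hf a b _ _); rewrite lexx ab.
pose J := (archimedean.Num.bound (K * (b - a) ^+ 2 / p)).+1.
have J0 : 0 < J%:R :> R by rewrite ltr0n.
pose d := (b - a) / J%:R.
have d0 : 0 <= d by rewrite divr_ge0 // subr_ge0.
have bJ : b = a + d * J%:R by rewrite /d divfK ?gt_eqF // addrC subrK.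
have step k : (k <= J)%N -> rnorm (f (a + d * k%:R) - f a) <= K * d ^+ 2 * k%:R.
  elim: k => [|k IH] kJ; first by rewrite !mulr0 addr0 subrr rnorm0.
  have kb j : (j <= J)%N -> a <= a + d * j%:R <= b.
    move=> jJ; rewrite lerDl mulr_ge0 //= bJ lerD2l ler_wpM2l // ler_nat //.
  rewrite -(subrKA (f (a + d * k%:R))) (le_trans (ler_rnormD _ _)) //.
  apply: le_trans (lerD (hf _ _ (kb _ (ltnW kJ)) (kb _ kJ)) (IH (ltnW kJ))) _.
  rewrite -natr1; have -> : a + d * (k%:R + 1) - (a + d * k%:R) = d by ring.
  lra.
have := step J (leqnn J); rewrite -bJ -/p.
have -> : K * d ^+ 2 * J%:R = K * (b - a) ^+ 2 / J%:R.
  by rewrite /d; field; rewrite gt_eqF.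
rewrite ler_pdivlMr // mulrC -ler_pdivlMr // leNgt => /negP; apply.
apply: (@lt_trans _ _ (J.-1)%:R); last by rewrite ltr_nat.
by apply: archi_boundP; rewrite divr_ge0 // ltW.
Qed.

(** * Roots of unity of order a power of two *)

(** A coherent choice of primitive [2^m]-th roots by iterated principal square roots of -1. Each
    root squares to the previous one, and from order 4 on its real part is nonnegative. *)
Definition root2 (R : realType) (m : nat) : complex R :=
  if m is m'.+1 then iter m' (@sqrtc R) (-1) else 1.

Section Root2.
Variable R : realType.
Local Notation w := (@root2 R).

Lemma root2S m : w m.+1 ^+ 2 = w m.
Proof. by case: m => [|m] /=; rewrite ?sqrrN ?expr1n // sqr_sqrtc. Qed.

Lemma root2_expN1 m : w m.+1 ^+ (2 ^ m) = -1.
Proof.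
by elim: m => [|m IH]; rewrite ?expr1 // expnS exprM root2S.
Qed.

Lemma root2_exp1 m : w m ^+ (2 ^ m) = 1.
Proof.
by case: m => [|m]; rewrite ?expr1n // expnSr exprM root2_expN1 sqrrN expr1n.
Qed.

Lemma cabs_root2 m : cabs (w m) = 1.
Proof.
elim: m => [|m IH]; first exact: cabs1.
apply/eqP; rewrite -(@eqrXn2 _ 2) ?cabs_ge0 // expr1n -cabsX root2S IH //.
Qed.

Lemma cabs_sqr (z : complex R) : cabs z ^+ 2 = complex.Re z ^+ 2 + complex.Im z ^+ 2.
Proof.
by rewrite /cabs normc_def /= sqr_sqrtr // addr_ge0 // sqr_ge0.
Qed.

Lemma Re_root2_ge0 m : 0 <= complex.Re (w m.+2).
Proof.
by rewrite /=; case: (iter _ _ _) => a b /=; exact: sqrtr_ge0.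
Qed.

(* [w k.+1 - 1 = (w k.+2 - 1) * (w k.+2 + 1)], and the last factor has modulus at
   least [sqrt 2 > 4 / 3]. *)
Lemma cabs_root2B1 m : cabs (w m - 1) <= 3 * (3 / 4) ^+ m.
Proof.
have contract k : cabs (w k.+2 - 1) <= 3 / 4 * cabs (w k.+1 - 1).
  have -> : w k.+1 - 1 = (w k.+2 - 1) * (w k.+2 + 1).
    by rewrite -subr_sqr root2S expr1n.
  rewrite cabsM; have := cabs_ge0 (w k.+2 - 1).
  have : 4 / 3 <= cabs (w k.+2 + 1).
    rewrite -(@ler_pXn2r _ 2) ?nnegrE ?cabs_ge0 //; last lra.
    rewrite cabs_sqr; have := cabs_sqr (w k.+2); rewrite cabs_root2.
    have := Re_root2_ge0 k; case: (w k.+2) => a b /=.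
    move=> a0 h; nra.
  nra.
case: m => [|m]; first by rewrite subrr /cabs normr0 expr0 mulr1.
elim: m => [|m IH].
  (* The constant 3 comes from here: the modulus 2 is at most [3 * (3 / 4)]. *)
  have -> : w 1 - 1 = ((-2)%:C)%C by rewrite /root2 /= rmorphN rmorph_nat; ring.
  by rewrite cabs_real normrN ger0_norm; lra.
apply: le_trans (contract m) _; rewrite (exprS _ m.+1); lra.
Qed.

Lemma root2_neq1 m : w m.+1 != 1.
Proof.
apply/eqP => w1; have := root2_expN1 m; rewrite w1 expr1n => /(congr1 (@complex.Re R)) /=; lra.
Qed.

(** An even exponent [2 k] reduces to [w m ^+ k]; for an odd exponent, the [2^m]-th power of
    [w m.+1 ^+ i] is -1. *)
Lemma root2_expr_neq1 m i : (0 < i < 2 ^ m)%N -> w m ^+ i != 1.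
Proof.
elim: m i => [|m IH] i; first by case: i => [|[]].
move=> /andP[i0 im]; apply/eqP => wi.
have [k ik] : exists k, i = k.*2 \/ i = k.*2.+1.
  exists i./2; rewrite -{1 3}(odd_double_half i); case: (odd i) => /=; by [right|left].
case: ik => ik.
  have /IH/eqP : (0 < k < 2 ^ m)%N.
    by rewrite ik double_gt0 expnS mul2n ltn_double in i0 im *; rewrite i0 im.
  by apply; rewrite -root2S -exprM mul2n -ik.
have : (w m.+1 ^+ i) ^+ (2 ^ m) = -1.
  rewrite -exprM mulnC exprM root2_expN1 ik exprS -mul2n exprM sqrrN expr1n expr1n mulr1 //.
by rewrite wi expr1n => /(congr1 (@complex.Re R)) /=; lra.
Qed.

End Root2.

(** * Means over equidistant points of a circle *)

Section CircleMean.
Variables (R : realType) (H : normedModType (complex R)).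
Local Notation C := (complex R).
Local Notation w := (@root2 R).

(** Riemann sum for the contour integral [(1/2 i pi) * \int phi(z) / z dz] over the circle through
    [t] centred at 0. *)
Definition circle_mean (m : nat) (phi : C -> H) (t : C) : H :=
  ((2 ^ m)%:R^-1 : C) *: \sum_(j < 2 ^ m) phi (t * w m ^+ j).

Lemma pow2_neq0 m : (2 ^ m)%:R != 0 :> C.
Proof. by rewrite pnatr_eq0 expn_eq0. Qed.

Lemma circle_meanD m phi psi t :
  circle_mean m (fun z => phi z + psi z) t =
  circle_mean m phi t + circle_mean m psi t.
Proof. by rewrite /circle_mean big_split scalerDr. Qed.

Lemma circle_mean_linear m (T : {linear H -> H}) phi t :
  T (circle_mean m phi t) = circle_mean m (T \o phi) t.
Proof. by rewrite /circle_mean linearZ linear_sum. Qed.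

Lemma circle_mean_cst m x t : circle_mean m (fun=> x) t = x.
Proof.
rewrite /circle_mean sumr_const card_ord -[x *+ _]scaler_nat scalerA mulVf ?scale1r //.
exact: pow2_neq0.
Qed.

(** The geometric sum with ratio [w m ^+ i] vanishes: the ratio differs from 1 but its [2^m]-th
    power is 1. Thus low monomials integrate to 0 exactly, without a limit. *)
Lemma circle_mean_expr m i x t : (0 < i < 2 ^ m)%N ->
  circle_mean m (fun z => z ^+ i *: x) t = 0.
Proof.
move=> im; rewrite /circle_mean -scaler_suml.
have -> : \sum_(j < 2 ^ m) (t * w m ^+ j) ^+ i =
    t ^+ i * \sum_(j < 2 ^ m) (w m ^+ i) ^+ j.
  by rewrite mulr_sumr; apply: eq_bigr => j _; rewrite exprMn exprAC.
suff -> : \sum_(j < 2 ^ m) (w m ^+ i) ^+ j = 0 by rewrite mulr0 scale0r scaler0.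
have wi : w m ^+ i - 1 != 0 by rewrite subr_eq0 root2_expr_neq1.
by apply: (mulfI wi); rewrite -subrX1 exprAC root2_exp1 expr1n subrr mulr0.
Qed.

Lemma cabs_mul_root2 m t j : cabs (t * w m ^+ j) = cabs t.
Proof. by rewrite cabsM cabsX cabs_root2 expr1n mulr1. Qed.

Lemma rnorm_mean_le m (F : 'I_(2 ^ m) -> H) M :
  (forall j, rnorm (F j) <= M) ->
  rnorm (((2 ^ m)%:R^-1 : C) *: \sum_(j < 2 ^ m) F j) <= M.
Proof.
move=> FM; rewrite rnormZ cabsV.
have -> : cabs ((2 ^ m)%:R : C) = (2 ^ m)%:R.
  by rewrite -(rmorph_nat (@real_complex R)) cabs_real ger0_norm.
rewrite mulrC ler_pdivrMr ?ltr0n ?expn_gt0 //.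
apply: le_trans (ler_rnorm_sum _ _ _) _.
apply: le_trans (ler_sum _ (fun j _ => FM j)) _.
by rewrite sumr_const card_ord mulr_natr.
Qed.

Lemma rnorm_circle_mean_le m phi t M :
  (forall z, cabs z = cabs t -> rnorm (phi z) <= M) ->
  rnorm (circle_mean m phi t) <= M.
Proof. by move=> h; apply: rnorm_mean_le => j; apply: h; exact: cabs_mul_root2. Qed.

Lemma circle_mean_rotate m phi t :
  circle_mean m phi (t * w m) = circle_mean m phi t.
Proof.
rewrite /circle_mean; congr (_ *: _).
have := root2_exp1 R m; have : (0 < 2 ^ m)%N by rewrite expn_gt0.
case: (2 ^ m)%N => // K _ wK.
rewrite big_ord_recr big_ord_recl /= -mulrA -exprS wK expr0 mulr1 addrC.
by congr (_ + _); apply: eq_bigr => j _; rewrite -mulrA -exprS.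
Qed.

(** Even powers of [w m.+1] are the powers of [w m]; odd ones are these rotated by [w m.+1]. *)
Lemma circle_mean_double m phi t :
  circle_mean m.+1 phi t =
  (2^-1 : C) *: (circle_mean m phi t + circle_mean m phi (t * w m.+1)).
Proof.
rewrite /circle_mean -scalerDr scalerA -big_split /=.
have -> : 2^-1 * (2 ^ m)%:R^-1 = (2 ^ m.+1)%:R^-1 :> C.
  by rewrite expnS natrM invfM.
congr (_ *: _); rewrite expnSr muln2; elim: (2 ^ m)%N => [|k IH].
  by rewrite !big_ord0.
rewrite doubleS !big_ord_recr /= IH -addrA; congr (_ + (phi _ + phi _)).
  by rewrite -(root2S R m) -exprM mul2n.
by rewrite -(root2S R m) -exprM mul2n -mulrA -exprS.
Qed.

(** By doubling, the increment is half the mean change of [phi] under rotation by [w m.+1], which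
    [cabs_root2B1] controls; the factor obtained is 9/8, rounded up to 2. *)
Lemma circle_mean_increment (phi : C -> H) t L m :
  (forall z z', cabs z = cabs t -> cabs z' = cabs t ->
     rnorm (phi z' - phi z) <= L * cabs (z' - z)) ->
  rnorm (circle_mean m.+1 phi t - circle_mean m phi t) <=
  2 * `|L| * cabs t * (3 / 4) ^+ m.
Proof.
move=> hL; rewrite circle_mean_double.
have -> a b : (2^-1 : C) *: (a + b) - a = (2^-1 : C) *: (b - a) :> H.
  rewrite -[X in _ - X]scale1r -[X in _ - X *: _](@mulVf C 2) ?pnatr_eq0 //.
  rewrite -scalerA -scalerBr scaler_nat mulr2n; congr (_ *: _).
  by rewrite opprD addrACA subrr add0r.
rewrite rnormZ -(rmorph_nat (@real_complex R)) -fmorphV cabs_real ger0_norm ?invr_ge0 //.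
rewrite ler_pdivrMl //.
rewrite /circle_mean -scalerBr -sumrB.
have := cabs_root2B1 R m.+1; have := cabs_ge0 (w m.+1 - 1).
set h := cabs _ => h0 hh.
apply: (@le_trans _ _ (`|L| * cabs t * h)).
  apply: rnorm_mean_le => j; apply: le_trans (hL _ _ _ _) _.
  - exact: cabs_mul_root2.
  - by rewrite cabs_mul_root2 cabsM cabs_root2 mulr1.
  rewrite -mulrBl -[X in _ - X]mulr1 -mulrBr !cabsM -/h.
  rewrite cabsX cabs_root2 expr1n mulr1 mulrA.
  by rewrite ler_wpM2r // ler_wpM2r ?cabs_ge0 // ler_norm.
have : 0 <= `|L| * cabs t by rewrite mulr_ge0 ?cabs_ge0.
rewrite exprS in hh; have : 0 <= (3 / 4 : R) ^+ m by rewrite exprn_ge0 //; lra.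
set x := _ * cabs t; set y := _ ^+ m in hh *; move=> y0 x0.
have := ler_wpM2l x0 hh; have : 0 <= x * y by rewrite mulr_ge0.
rewrite /x; lra.
Qed.

Section TwoRadii.
Variables (phi psi : C -> H) (r0 r1 K : R).
Hypotheses (r0_gt0 : 0 < r0) (K_ge0 : 0 <= K).
(** [psi] acts as the complex derivative of [phi] on the annulus, with a uniform quadratic
    remainder. *)
Hypothesis phi_psi : forall z z', r0 <= cabs z <= r1 -> r0 <= cabs z' <= r1 ->
  rnorm (phi z' - phi z - (z' - z) *: psi z) <= K * cabs (z' - z) ^+ 2.

Lemma circle_mean_taylor m t t' : r0 <= cabs t <= r1 -> r0 <= cabs t' <= r1 ->
  rnorm (circle_mean m phi t' - circle_mean m phi t - (t' - t) *:
    (((2 ^ m)%:R^-1 : C) *: \sum_(j < 2 ^ m) (w m ^+ j *: psi (t * w m ^+ j))))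
  <= K * cabs (t' - t) ^+ 2.
Proof.
move=> ht ht'; rewrite /circle_mean -scalerBr [_ *: (_ *: _)]scalerA mulrC.
rewrite -scalerA -scalerBr scaler_sumr -!sumrB.
apply: rnorm_mean_le => j; rewrite scalerA mulrBl.
apply: le_trans (phi_psi _ _) _; rewrite ?cabs_mul_root2 //.
by rewrite -mulrBl cabs_mul_root2.
Qed.

(* The first-order term of the Taylor expansion does not depend on the direction
   of the increment, and the mean is unchanged by the rotation [w m]: hence that
   term is small, also in the radial direction. *)
Lemma circle_mean_two_radii m (s t : R) : (0 < m)%N ->
  r0 <= s <= r1 -> r0 <= t <= r1 ->
  rnorm (circle_mean m phi (t%:C)%C - circle_mean m phi (s%:C)%C) <=
  K * (t - s) ^+ 2 + `|t - s| * K * r1 * cabs (w m - 1).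
Proof.
move=> m0 hs ht.
have s0 : 0 < s by case/andP: hs => h _; exact: lt_le_trans h.
have t0 : 0 < t by case/andP: ht => h _; exact: lt_le_trans h.
have cs : cabs (s%:C)%C = s by rewrite cabs_real gtr0_norm.
have ct : cabs (t%:C)%C = t by rewrite cabs_real gtr0_norm.
have := @circle_mean_taylor m (s%:C)%C (t%:C)%C; rewrite cs ct.
move=> /(_ hs ht); set G := _ *: \sum_(j < _) _ => h1.
have h0 : 0 < cabs (w m - 1).
  by rewrite cabs_gt0 subr_eq0; case: m m0 {h1 G} => // m _; exact: root2_neq1.
(* Moving from [s] to [s w] leaves the mean fixed, so the linear term [(s w - s) G] is itself of
   second order; dividing by [s |w - 1|] bounds [G]. *)
have := @circle_mean_taylor m (s%:C)%C ((s%:C)%C * w m).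
rewrite cabsM cs cabs_root2 mulr1 => /(_ hs hs).
rewrite -/G circle_mean_rotate subrr sub0r rnormN.
rewrite -[X in _ * _ - X]mulr1 -mulrBr rnormZ cabsM cs => h2.
have {h2}hG : rnorm G <= K * s * cabs (w m - 1).
  rewrite -(ler_pM2l (mulr_gt0 s0 h0)) (le_trans h2) // le_eqVlt; apply/orP; left.
  by apply/eqP; ring.
rewrite -rmorphB /= cabs_real in h1; rewrite real_normK ?num_real // in h1.
set d := _ - circle_mean _ _ _ in h1 *.
rewrite -[d](subrK ((t - s)%:C%C *: G)) (le_trans (ler_rnormD _ _)) //.
rewrite lerD // rnormZ cabs_real -!mulrA ler_wpM2l // (le_trans hG) //.
rewrite -!mulrA ler_wpM2l // ler_wpM2r ?cabs_ge0 //; by case/andP: hs.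
Qed.

(** As [m] grows, the error term of [circle_mean_two_radii] vanishes and only [K (t - s)^2] is left,
    so the limit has quadratic increments. *)
Lemma circle_mean_limit_const (D : R -> H) :
  (forall t, r0 <= t <= r1 -> (fun m => circle_mean m phi (t%:C)%C) @ \oo --> D t) ->
  forall t, r0 <= t <= r1 -> D r0 = D t.
Proof.
move=> hD t tr; have r0t : r0 <= t by case/andP: tr.
have tr1 : t <= r1 by case/andP: tr.
apply: (@quadratic_increments_const R H D K) => // a b /andP[ra at'] /andP[rb bt].
have har : r0 <= a <= r1 by rewrite ra (le_trans at').
have hbr : r0 <= b <= r1 by rewrite rb (le_trans bt).
apply/ler_addgt0Pr => e e0.
pose c := `|b - a| * K * r1 * 3.
have c0 : 0 <= c by rewrite !mulr_ge0 // (le_trans _ (le_trans r0t tr1)) // ltW.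
have e3 : 0 < e / 3 by rewrite divr_gt0.
have [N1 h1] := (rnorm_cvgP _ _).1 (hD a har) _ e3.
have [N2 h2] := (rnorm_cvgP _ _).1 (hD b hbr) _ e3.
have c1 : 0 < c + 1 by rewrite ltr_wpDl.
have /cvgrPdist_lt/(_ _ (divr_gt0 e3 c1))[N3 _ h3] :
    (fun n => (3 / 4 : R) ^+ n) @ \oo --> (0 : R).
  by apply: cvg_expr; rewrite ger0_norm //; lra.
pose m := maxn 1 (maxn N1 (maxn N2 N3)).
have {}h1 := h1 m; have {}h2 := h2 m; have {}h3 := h3 m.
have := @circle_mean_two_radii m a b.
rewrite /= !leq_max !leqnn !orbT in h1 h2 h3 *.
move=> /(_ isT har hbr) hm.
have {}h1 := h1 isT; have {}h2 := h2 isT; have {}h3 := h3 isT.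
rewrite sub0r normrN ger0_norm ?exprn_ge0 // in h3; last lra.
have {}hm : rnorm (circle_mean m phi (b%:C)%C - circle_mean m phi (a%:C)%C) <=
    K * (b - a) ^+ 2 + e / 3.
  apply: le_trans hm _; rewrite lerD2l.
  apply: (@le_trans _ _ (c * (3 / 4) ^+ m)).
    rewrite /c -!mulrA ler_wpM2l // ler_wpM2l // ler_wpM2l ?cabs_root2B1 //.
    by rewrite (le_trans (ltW r0_gt0)) // (le_trans r0t).
  rewrite ltr_pdivlMr // in h3.
  have : 0 <= (3 / 4 : R) ^+ m by rewrite exprn_ge0 //; lra.
  lra.
have -> : D b - D a = (D b - circle_mean m phi (b%:C)%C) +
    ((circle_mean m phi (b%:C)%C - circle_mean m phi (a%:C)%C) +
     (circle_mean m phi (a%:C)%C - D a)) by rewrite addrA !subrKA.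
have := ler_rnormD (D b - circle_mean m phi (b%:C)%C)
  ((circle_mean m phi (b%:C)%C - circle_mean m phi (a%:C)%C) +
   (circle_mean m phi (a%:C)%C - D a)).
have := ler_rnormD (circle_mean m phi (b%:C)%C - circle_mean m phi (a%:C)%C)
  (circle_mean m phi (a%:C)%C - D a).
rewrite (rnormB (D b)); lra.
Qed.

End TwoRadii.
End CircleMean.

(** * The Riesz decomposition at an isolated point *)

Lemma cabs_le_Re_Im (R : realType) (z : complex R) :
  cabs z <= `|complex.Re z| + `|complex.Im z|.
Proof.
rewrite -(@ler_pXn2r _ 2) ?nnegrE ?cabs_ge0 ?addr_ge0 // cabs_sqr.
rewrite sqrrD !real_normK ?num_real // lerD2r lerDl mulrn_wge0 // mulr_ge0 //.
Qed.

Lemma cabs_ge_Re_Im (R : realType) (z : complex R) :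
  `|complex.Re z| <= cabs z /\ `|complex.Im z| <= cabs z.
Proof.
split; rewrite -(@ler_pXn2r _ 2) ?nnegrE ?cabs_ge0 //;
  by rewrite cabs_sqr real_normK ?num_real // ?lerDl ?lerDr sqr_ge0.
Qed.

Lemma op_shift_is_linear (R : realType) (H : normedModType (complex R))
    (A : {linear H -> H}) (l : complex R) : linear (op_shift A l).
Proof.
move=> a x y; rewrite /op_shift linearP scalerBr scalerDr !scalerA mulrC.
by rewrite opprD addrACA.
Qed.

HB.instance Definition _ (R : realType) (H : normedModType (complex R))
    (A : {linear H -> H}) (l : complex R) :=
  GRing.isLinear.Build (complex R) H H *:%R (op_shift A l) (op_shift_is_linear A l).

Lemma iter_is_linear (R : realType) (H : normedModType (complex R))
    (A : {linear H -> H}) n : linear (iter n A).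
Proof. by move=> a x y; elim: n => [//|n IH]; rewrite !iterS IH linearP. Qed.

HB.instance Definition _ (R : realType) (H : normedModType (complex R))
    (A : {linear H -> H}) n :=
  GRing.isLinear.Build (complex R) H H *:%R (iter n A) (iter_is_linear A n).

(** The inverse of a linear map is linear, hence bounded once continuous; [1 / M] is the lower
    bound. *)
Lemma invertible_bounded_below (R : realType) (H : normedModType (complex R))
    (T : {linear H -> H}) : invertible_op T ->
  exists2 c : R, 0 < c & forall x, c * rnorm x <= rnorm (T x).
Proof.
move=> [S [cS [ST TS]]].
have Slin : linear S.
  by move=> a x y; rewrite -{1}(TS x) -{1}(TS y) -linearP ST.
pose SL := GRing.isLinear.Build _ _ _ _ S Slin.
pose S' : {linear H -> H} := HB.pack S SL.
have [M M0 hM] := @continuous_linear_rnorm _ _ S' cS.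
exists M^-1; first by rewrite invr_gt0.
by move=> x; rewrite mulrC ler_pdivrMr // mulrC -{1}(ST x); exact: hM.
Qed.

(** Compactness of the annulus: a lower bound [c] at [z] yields [c / 2] within distance [c / 2] of
    [z]. A point outside has a neighbourhood missing the annulus, where the claim is vacuous, so a
    whole square can be covered. *)
Lemma uniformly_bounded_below (R : realType) (H : normedModType (complex R))
    (T : H -> H) (r0 r1 : R) :
  (forall z, r0 <= cabs z <= r1 ->
     exists2 c, 0 < c & forall x, c * rnorm x <= rnorm (op_shift T z x)) ->
  exists2 c, 0 < c & forall z, r0 <= cabs z <= r1 ->
     forall x, c * rnorm x <= rnorm (op_shift T z x).
Proof.
move=> hT.
pose P (c : R) (p : R * R) := let z := Complex p.1 p.2 in
  r0 <= cabs z <= r1 -> forall x, c * rnorm x <= rnorm (op_shift T z x).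
(* Near-covering, used with [c] tending to 0 from the right, stands in for the minimum over a finite
   subcover. *)
have /compact_near_coveringP cov := compact_setX (@segment_compact R (-r1) r1)
  (@segment_compact R (-r1) r1).
have near0 (d : R) : 0 < d -> \forall c \near 0^'+, c <= d.
  by move=> d0; near=> c; near: c; apply: nbhs_right_le.
have nearp (p : R * R) (d : R) : 0 < d ->
    \forall q \near p, cabs (Complex q.1 q.2 - Complex p.1 p.2) < d.
  move=> d0; have d2 : 0 < d / 2 by rewrite divr_gt0.
  apply: filterS (nbhsx_ballx p _ d2) => q [/= q1 q2].
  apply: le_lt_trans (cabs_le_Re_Im _) _ => /=.
  rewrite /ball /= in q1 q2; rewrite distrC (distrC q.2); lra.
have key (p : R * R) : exists2 d, 0 < d & forall c q, c <= d ->
    cabs (Complex q.1 q.2 - Complex p.1 p.2) < d -> P c q.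
  set z := Complex p.1 p.2.
  have [/hT[c c0 hc]|zout] := boolP (r0 <= cabs z <= r1).
    exists (c / 2); first by rewrite divr_gt0.
    move=> d q dc; rewrite -/z /P; set z' := Complex q.1 q.2 => zz' _ x.
    have -> : op_shift T z' x = op_shift T z x - (z' - z) *: x.
      by rewrite /op_shift scalerBl opprB addrA subrK.
    have h1 := ler_rnormB (op_shift T z x - (z' - z) *: x) (- ((z' - z) *: x)).
    rewrite opprK subrK rnormN rnormZ in h1.
    have h2 := hc x; have x0 := rnorm_ge0 x.
    have := ler_wpM2r x0 (ltW zz'); have := ler_wpM2r x0 dc; lra.
  have {zout} [d d0 hd] : exists2 d, 0 < d & forall z', cabs (z' - z) < d ->
      ~~ (r0 <= cabs z' <= r1).
    rewrite negb_and -!ltNge in zout.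
    have tri z' := ler_cabsD (z' - z) z; have tri' z' := ler_cabsD (z - z') z'.
    case/orP: zout => h.
      exists (r0 - cabs z); first by rewrite subr_gt0.
      move=> z' hz; have := tri z'; rewrite subrK negb_and -!ltNge => h'.
      by apply/orP; left; lra.
    exists (cabs z - r1); first by rewrite subr_gt0.
    move=> z' hz; have := tri' z'; rewrite subrK cabsB negb_and -!ltNge => h'.
    by apply/orP; right; lra.
  by exists d => // c q _ /hd zout; rewrite /P /= (negbTE zout).
have := cov R (0^'+) P _; case=> [p _|d d0 hd].
  have [d d0 hd] := key p.
  exists ([set q | cabs (Complex q.1 q.2 - Complex p.1 p.2) < d], [set c | c <= d]).
    by split; [exact: nearp | exact: near0].
  by move=> [q c] [/= h1 h2]; exact: hd.
exists (d / 2); first by rewrite divr_gt0.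
have {}hd : `[-r1, r1]%classic `*` `[-r1, r1]%classic `<=` P (d / 2).
  apply: hd; last by rewrite /= divr_gt0.
  rewrite /= sub0r normrN gtr0_norm ?divr_gt0 //. rewrite /= in d0; lra.
move=> z zin; have z1 : cabs z <= r1 by case/andP: zin.
have [hr hi] := cabs_ge_Re_Im z.
have /hd : (`[-r1, r1]%classic `*` `[-r1, r1]%classic) (complex.Re z, complex.Im z).
  by split; rewrite /= in_itv /= -ler_norml; exact: le_trans z1.
by case: z zin {z1 hr hi} => a b zin; apply.
Unshelve. all: by end_near. Qed.

Lemma rnorm_lim_le (R : realType) (H : normedModType (complex R))
    (u : nat -> H) (l : H) (b : R) N : u @ \oo --> l ->
  (forall m, (N <= m)%N -> rnorm (u m) <= b) -> rnorm l <= b.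
Proof.
move=> /rnorm_cvgP ul ub; apply/ler_addgt0Pr => e /ul[N' hN'].
have := hN' (maxn N N') (leq_maxr _ _); have := ub (maxn N N') (leq_maxl _ _).
have := ler_rnormB (u (maxn N N')) (u (maxn N N') - l); rewrite subKr; lra.
Qed.

Lemma eq_circle_mean (R : realType) (H : normedModType (complex R)) m
    (phi psi : complex R -> H) t :
  (forall z, cabs z = cabs t -> phi z = psi z) ->
  circle_mean m phi t = circle_mean m psi t.
Proof.
move=> h; congr (_ *: _); apply: eq_bigr => j _; apply: h.
exact: cabs_mul_root2.
Qed.

(* [B x] is the contour integral [(1/2 i pi) * \int z^-1 (T - z)^-1 x dz] over a
   small circle around [0]; [x - T (B x)] is then the Riesz projection of [x]. *)
Lemma isolated_riesz_decomposition (R : realType)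
    (H : completeNormedModType (complex R)) (T : {linear H -> H}) (eps : R) :
  continuous T -> 0 < eps ->
  (forall z, 0 < cabs z < eps -> invertible_op (op_shift T z)) ->
  exists B : H -> H, exists2 M : R, 0 <= M &
    forall x, rnorm (B x) <= M * rnorm x /\ rapid_decay T (x - T (B x)).
Proof.
move=> cT eps0 invT.
have [S hS] : exists S : complex R -> H -> H, forall z, 0 < cabs z < eps ->
    (forall x, S z (op_shift T z x) = x) /\ (forall x, op_shift T z (S z x) = x).
  have /choice[S hS] : forall z, exists S : H -> H, 0 < cabs z < eps ->
      (forall x, S (op_shift T z x) = x) /\ (forall x, op_shift T z (S x) = x).
    move=> z; have [/invT[S [_ ?]]|?] := boolP (0 < cabs z < eps); first by exists S.
    (* Off the punctured disc the value is a mere default. *)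
    by exists id.
  by exists S.
have TS z x : 0 < cabs z < eps -> T (S z x) = x + z *: S z x.
  by move=> /hS[_ h]; rewrite -{2}(h x) /op_shift subrK.
have TB a u v : T (u - a *: v) = T u - a *: T v by rewrite linearB linearZ.
have inj z x y : 0 < cabs z < eps -> op_shift T z x = op_shift T z y -> x = y.
  by move=> /hS[h _] xy; rewrite -(h x) xy h.
have SL z a x y : 0 < cabs z < eps -> S z (a *: x + y) = a *: S z x + S z y.
  by move=> hz; apply: (inj z) => //; have [_ h] := hS z hz; rewrite linearP /= !h.
have S0 z : 0 < cabs z < eps -> S z 0 = 0.
  by move=> hz; apply: (inj z) => //; have [_ ->] := hS z hz; rewrite linear0.
have resolvent z z' x : 0 < cabs z < eps -> 0 < cabs z' < eps ->
    S z' x - S z x = (z' - z) *: S z' (S z x).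
  move=> hz hz'; have [_ h] := hS z' hz'.
  apply: (inj z') => //; rewrite linearB linearZ /= !h /op_shift TS //.
  by rewrite scalerBl opprB opprD addrCA addNKr.
pose r1 := eps / 2.
have r1_gt0 : 0 < r1 by rewrite divr_gt0.
have r1_lt : r1 < eps by rewrite /r1; lra.
have pdisc r0 z : 0 < r0 -> r0 <= cabs z <= r1 -> 0 < cabs z < eps.
  by move=> r0p /andP[h1 h2]; rewrite (lt_le_trans r0p) //= (le_lt_trans h2).
have bound r0 : 0 < r0 -> exists2 M, 0 <= M & forall z x,
    r0 <= cabs z <= r1 -> rnorm (S z x) <= M * rnorm x.
  move=> r0p; have [z hz|c c0 hc] := @uniformly_bounded_below _ _ T r0 r1.
    exact: invertible_bounded_below (invT z (pdisc _ _ r0p hz)).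
  exists c^-1; first by rewrite invr_ge0 ltW.
  move=> z x hz; rewrite mulrC ler_pdivlMr // mulrC.
  by have [_ h] := hS z (pdisc _ _ r0p hz); rewrite -[in leRHS](h x) hc.
(* Applied once, the resolvent identity gives a Lipschitz bound with [M^2]; applied twice, a Taylor
   bound with [M^3] and derivative [S z (S z x)]. *)
have lip r0 : 0 < r0 -> exists2 L, 0 <= L & forall x z z',
    r0 <= cabs z <= r1 -> r0 <= cabs z' <= r1 ->
    rnorm (S z' x - S z x) <= L * rnorm x * cabs (z' - z) /\
    rnorm (S z' x - S z x - (z' - z) *: S z (S z x)) <=
      L * rnorm x * cabs (z' - z) ^+ 2.
  move=> r0p; have [M M0 hM] := bound r0 r0p.
  exists (M ^+ 2 + M ^+ 3); first by rewrite addr_ge0 ?exprn_ge0.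
  move=> x z z' hz hz'; have dz := pdisc _ _ r0p hz; have dz' := pdisc _ _ r0p hz'.
  have n0 := rnorm_ge0 x; have c0 := cabs_ge0 (z' - z).
  have M2 : rnorm (S z (S z x)) <= M ^+ 2 * rnorm x.
    by rewrite (le_trans (hM _ _ hz)) // expr2 -mulrA ler_wpM2l ?hM.
  rewrite resolvent //; split.
    rewrite rnormZ mulrC ler_wpM2r // (le_trans (hM _ _ hz')) //.
    have := ler_wpM2l M0 (hM z x hz); have : 0 <= M ^+ 3 * rnorm x.
      by rewrite mulr_ge0 ?exprn_ge0.
    lra.
  rewrite -scalerBr resolvent // scalerA rnormZ mulrC -expr2 cabsX.
  rewrite ler_wpM2r ?exprn_ge0 // (le_trans (hM _ _ hz')) //.
  have := ler_wpM2l M0 M2; have : 0 <= M ^+ 2 * rnorm x.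
    by rewrite mulr_ge0 ?exprn_ge0.
  rewrite [_ ^+ 3]exprS; lra.
pose D x (t : R) := lim ((fun m => circle_mean m (S^~ x) (t%:C)%C) @ \oo).
have cvgD x t : 0 < t <= r1 ->
    (fun m => circle_mean m (S^~ x) (t%:C)%C) @ \oo --> D x t.
  move=> /andP[t0 t1]; have [L L0 hL] := lip t t0.
  have ct : cabs (t%:C)%C = t by rewrite cabs_real gtr0_norm.
  suff [l hl] : exists l : H, (fun m => circle_mean m (S^~ x) (t%:C)%C) @ \oo --> l.
    by apply: cvgP hl.
  apply: (@rnorm_geometric_cvg _ _ _ (2 * `|L * rnorm x| * t)) => m.
  rewrite -[in leRHS]ct; apply: circle_mean_increment => z z'; rewrite ct => hz hz'.
  by have [] := hL x z z'; rewrite ?hz ?hz' ?lexx.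
have D_const x r0 : 0 < r0 <= r1 -> D x r0 = D x r1.
  move=> /andP[r0p r01]; have [L L0 hL] := lip r0 r0p.
  apply: (@circle_mean_limit_const _ _ (S^~ x) (fun z => S z (S z x)) r0 r1
    (L * rnorm x)) => //.
  - by rewrite mulr_ge0 ?rnorm_ge0.
  - by move=> z z' hz hz'; have [] := hL x z z' hz hz'.
  - by move=> t /andP[h1 h2]; apply: cvgD; rewrite h2 (lt_le_trans r0p).
  - by rewrite r01 lexx.
have [M1 M10 hM1] := bound r1 r1_gt0.
exists (fun x => D x r1), M1 => // x; split.
  have r1r1 : 0 < r1 <= r1 by rewrite r1_gt0 lexx.
  apply: (rnorm_lim_le (N := 0%N) (cvgD x r1 r1r1)) => m _.
  apply: rnorm_circle_mean_le => z; rewrite cabs_real gtr0_norm // => hz.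
  by rewrite hM1 // hz lexx.
(* Radius independence allows a circle of radius at most [r] to be used for decay at rate [r]. *)
move=> r r_gt0; pose r0 := Num.min r r1.
have r0p : 0 < r0 by rewrite lt_min r_gt0.
have r01 : r0 <= r1 by rewrite ge_min lexx orbT.
have cr0 : cabs (r0%:C)%C = r0 by rewrite cabs_real gtr0_norm.
have [M M0 hM] := bound r0 r0p; exists (r0 * M * rnorm x) => k.
rewrite -(D_const x r0) ?r0p //.
(* Each [T] turns into a factor [z], since [T (S z x) = x + z S z x] and the monomial coming from
   the first summand has mean 0 as long as its degree stays below [2^m]. *)
have tele m j : (0 < j)%N -> (j + k <= 2 ^ m)%N ->
    circle_mean m (fun z => z ^+ j *: iter k T (S z x)) (r0%:C)%C =
    circle_mean m (fun z => z ^+ (j + k) *: S z x) (r0%:C)%C.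
  elim: k j => [|k IH] j j0 jk; first by rewrite addn0.
  rewrite addnS -addSn -IH ?addSn -?addnS //.
  rewrite -[RHS]add0r -(@circle_mean_expr _ _ m j (iter k T x) (r0%:C)%C); last first.
    by rewrite j0 (leq_trans _ jk) // addnS ltnS leq_addr.
  rewrite -circle_meanD; apply: eq_circle_mean => z; rewrite cr0 => hz.
  rewrite iterSr TS; last by rewrite (pdisc r0) // hz lexx.
  by rewrite linearD linearZ /= scalerDr scalerA -exprSr.
have [MT MT0 hMT] := continuous_linear_rnorm cT.
(* The estimate is proved for the discrete means and passed to the limit; [m > k] guarantees
   [1 + k <= 2^m] for [tele]. *)
apply: (@rnorm_lim_le _ _ (fun m => iter k T (x - T (circle_mean m (S^~ x) (r0%:C)%C)))
  _ _ k.+1).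
  apply/rnorm_cvgP => e e0; have q0 : 0 < MT ^+ k.+1 by rewrite exprn_gt0.
  have [|N hN] := (rnorm_cvgP _ _).1 (cvgD x r0 _) _ (divr_gt0 e0 q0).
    by rewrite r0p.
  exists N => m /hN; rewrite ltr_pdivlMr // mulrC; apply: le_lt_trans.
  have -> a b : iter k T (x - T a) - iter k T (x - T b) = iter k.+1 T (b - a).
    by rewrite iterSr -linearB opprB addrC subrKA [T (b - a)]linearB.
  rewrite rnormB; exact: rnorm_iter_le (ltW MT0) hMT.
move=> m km.
(* Averaging [T (S z x) = x + z S z x] cancels the constant [x]. *)
have -> : x - T (circle_mean m (S^~ x) (r0%:C)%C) =
    - circle_mean m (fun z => z ^+ 1 *: S z x) (r0%:C)%C.
  apply/eqP; rewrite circle_mean_linear subr_eq addrC eq_sym subr_eq.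
  rewrite -[X in _ == X + _](circle_mean_cst m x (r0%:C)%C) -circle_meanD; apply/eqP.
  apply: eq_circle_mean => z; rewrite cr0 => hz /=.
  by rewrite TS // (pdisc r0) // hz lexx.
rewrite linearN rnormN circle_mean_linear /=.
have -> : circle_mean m (iter k T \o (fun z => z ^+ 1 *: S z x)) (r0%:C)%C =
    circle_mean m (fun z => z ^+ (1 + k) *: S z x) (r0%:C)%C.
  rewrite -tele //; last by rewrite add1n (leq_trans km) // ltnW // ltn_expl.
  by apply: eq_circle_mean => z _ /=; rewrite linearZ.
apply: rnorm_circle_mean_le => z; rewrite cr0 => hz.
rewrite rnormZ cabsX hz exprS -mulrA.
apply: (@le_trans _ _ (r0 * (r0 ^+ k * (M * rnorm x)))).
  by rewrite ler_pM2l // ler_wpM2l ?exprn_ge0 ?hM ?hz ?lexx // ltW.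
rewrite -!mulrA ler_pM2l // mulrC -mulrA ler_wpM2l // ler_wpM2l ?rnorm_ge0 //.
by rewrite lerXn2r ?nnegrE ?(ltW r0p) ?(ltW r_gt0) // /r0 ge_min lexx.
Qed.

(** * Ascent and descent *)

Section AscentDescent.
Variables (R : realType) (H : normedModType (complex R)) (T : {linear H -> H}).

Lemma op_ker_stable p : op_ker T p = op_ker T p.+1 ->
  forall k x, iter (p + k) T x = 0 -> iter p T x = 0.
Proof.
move=> kp; elim=> [|k IH] x; first by rewrite addn0.
rewrite addnS iterSr => /IH; rewrite -iterSr => h.
by have : op_ker T p x by rewrite kp.
Qed.

Lemma op_range_stable q : op_range T q = op_range T q.+1 ->
  forall k x, exists y, iter q T x = iter (q + k) T y.
Proof.
move=> rq; elim=> [|k IH] x; first by exists x; rewrite addn0.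
have [y ->] := IH x.
have : op_range T q.+1 (iter q T y) by rewrite -rq; exists y.
by case=> z _ zy; exists z; rewrite (addnC q k) iterD -zy -iterD !addnS (addnC q).
Qed.

Lemma op_rangeS_sub q : op_range T q.+1 `<=` op_range T q.
Proof. by move=> y [x _ <-]; exists (T x) => //; rewrite iterSr. Qed.

Lemma op_kerS_sup q : op_ker T q `<=` op_ker T q.+1.
Proof. by move=> x; rewrite /op_ker /= => ->; rewrite linear0. Qed.

(** For stable kernels at [q], write [T^(p+q) x = T^(p+q+1) y]; then [T^q (x - T y)] is killed by
    [T^p], hence is 0. For stable ranges and [x] in [ker T^(q+1)], write [T^q x = T^(q+p) y]; then
    [T^(p+q+1) y = 0] forces [T^p y = 0]. *)
Lemma op_ker_range_stable p q :
  op_ker T p = op_ker T p.+1 -> op_range T p = op_range T p.+1 ->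
  op_ker T q = op_ker T q.+1 <-> op_range T q = op_range T q.+1.
Proof.
move=> kp rp; split=> [kq|rq]; apply/seteqP; split.
- move=> _ [x _ <-]; have [y xy] := op_range_stable rp q.+1 (iter q T x).
  exists y => //; apply/esym/subr0_eq.
  rewrite iterSr -linearB; apply: (op_ker_stable kq (k := p)).
  by rewrite addnC iterD !linearB /= xy -!iterD -iterSr addnS subrr.
- exact: op_rangeS_sub.
- exact: op_kerS_sup.
- move=> x qx; have [y xy] := op_range_stable rq p x.
  have py : iter p T y = 0.
    by apply: (op_ker_stable kp (k := q.+1)); rewrite addnC addSn iterS -xy.
  by rewrite /op_ker /= xy iterD py linear0.
Qed.

(** The least stable index for kernels is also the least one for ranges, by the equivalence
    above. *)
Lemma ascent_descent_of_stable p :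
  op_ker T p = op_ker T p.+1 -> op_range T p = op_range T p.+1 ->
  exists q, is_ascent T q /\ is_descent T q.
Proof.
move=> kp rp.
have ex : exists q, `[< op_ker T q = op_ker T q.+1 >] by exists p; apply/asboolP.
case: (ex_minnP ex) => q /asboolP kq qmin; exists q.
split; (split=> [|j jq]).
- exact: kq.
- by move=> /asboolP/qmin; rewrite leqNgt jq.
- exact/(op_ker_range_stable q kp rp).
- by move=> /(op_ker_range_stable j kp rp)/asboolP/qmin; rewrite leqNgt jq.
Qed.

End AscentDescent.

(** * Poles, and the conclusion *)

Lemma rapid_decay_ker_pole (R : realType) (H : completeNormedModType (complex R))
    (T : {linear H -> H}) (eps : R) p :
  continuous T -> 0 < eps -> ~ invertible_op T ->
  (forall z, 0 < cabs z < eps -> invertible_op (op_shift T z)) ->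
  (forall x, rapid_decay T x -> iter p T x = 0) ->
  exists q, (0 < q)%N /\ is_ascent T q /\ is_descent T q.
Proof.
move=> cT eps0 Tsing Tinv decay.
have [B [M M0 hB]] := isolated_riesz_decomposition cT eps0 Tinv.
have pB x : iter p T x = iter p.+1 T (B x).
  by apply/subr0_eq; have := decay _ (hB x).2; rewrite linearB iterSr.
have [||q [aq dq]] := @ascent_descent_of_stable _ _ T p.
(* A vector of [ker T^(p+1)] has eventually zero iterates, so it decays rapidly and [decay] puts it
   in [ker T^p]. *)
- apply/seteqP; split; first exact: op_kerS_sup.
  move=> x px; apply: decay => r r0.
  apply: (@eventually_le_geometric _ (fun k => rnorm (iter k T x)) _ p.+1) => //.
    by move=> k; exact: rnorm_ge0.
  by move=> k pk; rewrite (iter_ker pk px) rnorm0 exprn_ge0 // ltW.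
- apply/seteqP; split; last exact: op_rangeS_sub.
  by move=> _ [x _ <-]; exists (B x); rewrite // -pB.
(* Ascent 0 makes [T] injective, so [x - T (B x)], killed by [T^p], is 0 and [B] is a right
   inverse. *)
exists q; split=> //; rewrite lt0n; apply/eqP => q0; apply: Tsing.
have inj x : T x = 0 -> x = 0.
  by move: aq; rewrite q0 => -[k0 _] Tx; have : op_ker T 0 x by rewrite k0.
have injp k x : iter k T x = 0 -> x = 0.
  by elim: k => [//|k IH]; rewrite iterS => /inj.
have TB x : T (B x) = x.
  by apply/esym/subr0_eq/(injp p)/decay; have [] := hB x.
have TI x y : T x = T y -> x = y.
  by move=> xy; apply/subr0_eq/inj; rewrite linearB xy subrr.
exists B; split; last by split=> // x; exact: TI.
apply: (@rnorm_bound_continuous _ _ _ M) => x y.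
(* [B] is additive because [T] is injective and [T (B x - B y) = x - y]. *)
suff -> : B x - B y = B (x - y) by have [] := hB (x - y).
by apply: TI; rewrite linearB !TB.
Qed.

Lemma op_shift_continuous (R : realType) (H : normedModType (complex R))
    (A : {linear H -> H}) (l : complex R) :
  continuous A -> continuous (op_shift A l).
Proof.
move=> /continuous_linear_rnorm[M M0 hM].
apply: (@rnorm_bound_continuous _ _ _ (M + cabs l)) => x y.
rewrite -(linearB (op_shift A l)) mulrDl -rnormZ.
exact: le_trans (ler_rnormB _ _) (lerD (hM _) (lexx _)).
Qed.

Lemma op_shiftD (R : realType) (H : normedModType (complex R)) (A : H -> H)
    (l z : complex R) : op_shift (op_shift A l) z = op_shift A (l + z).
Proof. by apply/funext => x; rewrite /op_shift scalerDl opprD addrA. Qed.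

Lemma op_shift0 (R : realType) (H : normedModType (complex R)) (A : H -> H) :
  op_shift A 0 = A.
Proof. by apply/funext => x; rewrite /op_shift scale0r subr0. Qed.

Theorem theorem3p3 (R : realType) (H : completeNormedModType (complex R))
  (ip : H -> H -> complex R) (hip : is_inner_product ip)
  (hinf : infinite_dim H)
  (n : nat) (hn : (1 < n)%N)
  (A : {linear H -> H}) (hA : continuous A)
  (Astar : H -> H) (hadj : is_adjoint ip A Astar)
  (hcomm : forall x : H, Astar (iter n A x) = iter n A (Astar x)) :
  (forall l : complex R, l != 0 -> op_spectrum (A : H -> H) l ->
     qnil_part (op_shift A l) = op_ker (op_shift A l) 1)
  /\ qnil_part (A : H -> H) = op_ker A n
  /\ op_polaroid (A : H -> H).
Proof.
have n0 : (0 < n)%N by exact: ltnW.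
(* At [k = n] this is normality of [A^n], whose adjoint is [Astar^n]. *)
have comm k x : iter k Astar (iter n A x) = iter n A (iter k Astar x).
  by elim: k => [//|k IH]; rewrite !iterS IH hcomm.
have normal_decay m x : rapid_decay (op_shift (iter n A) m) x ->
    op_shift (iter n A) m x = 0.
  apply: paranormal_rapid_decay => y.
  exact: (@normal_shift_paranormal _ _ _ hip (iter n A) _ (is_adjoint_iter hadj n) (comm n)).
have decay0 x : rapid_decay A x -> iter n A x = 0.
  move=> /(iter_rapid_decay n0) dx; rewrite -(op_shift0 (iter n A)).
  by apply: normal_decay; rewrite op_shift0.
have decayS l x : l != 0 -> rapid_decay (op_shift A l) x -> op_shift A l x = 0.
  by move=> l0; apply: (power_rapid_decay hA n0 l0 (normal_decay _)).
split; [move=> l l0 _|split].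
- apply/seteqP; split; last exact: ker_qnil.
  by move=> x /qnil_rapid_decay dx; exact: decayS.
- apply/seteqP; split; last exact: ker_qnil.
  by move=> x /qnil_rapid_decay/decay0.
move=> l [sl [e e0 iso]].
(* Rapidly decaying vectors lie in [ker A^n] when [l = 0] and in [ker (A - l)] otherwise, hence the
   two exponents. *)
apply: (@rapid_decay_ker_pole _ _ (op_shift A l) e (if l == 0 then n else 1%N)) => //.
- exact: op_shift_continuous.
- move=> z /andP[z0 ze]; apply: contrapT; rewrite op_shiftD => sz.
  have := iso (l + z) sz; rewrite [l + z]addrC addrK => /(_ ze)/eqP.
  rewrite -[X in _ == X]add0r (inj_eq (addIr l)) => /eqP zz.
  by rewrite zz /cabs normr0 ltxx in z0.
- move=> x; have [->|l0] := eqVneq l 0; last exact: decayS.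
  have d0 : rapid_decay (op_shift A 0) x -> iter n (op_shift A 0) x = 0.
    by rewrite op_shift0; exact: decay0.
  exact: d0.
Qed.
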